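(* Let $n\ge 1$, let $\varphi:\mathbb{R}^n\to\mathbb{R}$ be a smooth dispersion relation of sum type, and suppose that for some $\alpha>1$ $$|\nabla\varphi(\xi)|\sim N^{\alpha-1}\quad\text{for all } N\in 2^{\mathbb{N}_0}\text{ and all }\xi\in\mathbb{R}^n\text{ with } N\le|\xi|<2N.$$ Then for all $K,N\in 2^{\mathbb{N}_0}$ with $K\ll N$ and all $u_1,u_2\in L^2(\mathbb{T}^n)$, $$\big\|P_N e^{it\varphi(\nabla/i)}u_1\; P_K e^{it\varphi(\nabla/i)}u_2\big\|_{L^2_t([0,N^{-(\alpha-1)}],L^2(\mathbb{T}^n))}\lesssim \frac{K^{\frac{n-1}{2}}}{N^{\frac{\alpha-1}{2}}}\,\|P_N u_1\|_{L^2(\mathbb{T}^n)}\|P_K u_2\|_{L^2(\mathbb{T}^n)}.$$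
   Context: $\mathbb{T}=\mathbb{R}/2\pi\mathbb{Z}$, and functions on $\mathbb{T}^n$ are complex-valued. A dispersion relation $\varphi:\mathbb{R}^n\to\mathbb{R}$ is of sum type if $\varphi(\xi)=\sum_{i=1}^n\mu(\xi_i)$ with $\mu:\mathbb{R}\to\mathbb{R}$ slowly varying, i.e. $\mu(x)\sim\mu(2x)$ for any $x\ne 0$ (with constants independent of $x$). The propagator is the Fourier multiplier $(e^{it\varphi(\nabla/i)}f)^\wedge(\xi)=e^{it\varphi(\xi)}\hat f(\xi)$, $\xi\in\mathbb{Z}^n$. The frequency projectors are $(P_Nf)^\wedge(\xi)=1_{[N,2N)}(|\xi|)\hat f(\xi)$ for $N\in 2^{\mathbb{N}}$ (i.e. $N=2,4,8,\dots$) and $(P_1f)^\wedge(\xi)=1_{[0,2)}(|\xi|)\hat f(\xi)$. $A\lesssim B$ means $A\le CB$ and $A\sim B$ means $A\lesssim B\lesssim A$; $K\ll N$ means $K\le cN$ for a sufficiently small constant $c>0$; the constants $c$ and $C$ depend only on $n$ and $\varphi$ (including $\alpha$). *)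

(* Defs.v *)
From HB Require Import structures.
From mathcomp Require Import all_boot all_order all_algebra.
From mathcomp Require Import all_classical all_reals all_analysis.
From mathcomp Require Import complex zify.

Set Implicit Arguments.
Unset Strict Implicit.
Unset Printing Implicit Defensive.
Import Order.TTheory GRing.Theory Num.Theory.
Import numFieldNormedType.Exports.
Local Open Scope classical_set_scope.
Local Open Scope ring_scope.

(** The torus T^n = (R/2piZ)^n.  Functions on T^n are functions on R^n that are
    2pi-periodic in each coordinate; integration over T^n is integration over
    the fundamental domain [0, 2pi)^n.  Points of R^n are tuples here because
    tuples carry the product sigma-algebra; [measurableTypeR R] is R with its
    Borel sigma-algebra. *)
Notation torus R n := (n.-tuple (measurableTypeR R)) (only parsing).

Definition circle_measure (R : realType) : set (measurableTypeR R) -> \bar R :=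
  mrestr (@lebesgue_measure R) (measurable_itv `[0, 2 * pi[).

HB.instance Definition _ (R : realType) :=
  Measure.copy (@circle_measure R)
    (mrestr (@lebesgue_measure R) (measurable_itv `[0, 2 * pi[)).

Lemma circle_measure_fin (R : realType) : fin_num_fun (@circle_measure R).
Proof.
move=> A mA; rewrite ge0_fin_numE// /circle_measure /mrestr.
have mI : measurable (`[0, 2 * pi[%classic : set (measurableTypeR R)).
  exact: measurable_itv.
apply: (@le_lt_trans _ _ (@lebesgue_measure R `[0, 2 * pi[%classic)).
  by apply: le_measure; rewrite ?inE//; apply: measurableI.
by rewrite lebesgue_measure_itv/=; case: ifP => _; rewrite -?EFinB ltry.
Qed.

HB.instance Definition _ (R : realType) :=
  Measure_isFinite.Build _ _ _ (@circle_measure R) (@circle_measure_fin R).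

Section circle_times.
Context (R : realType) (n : nat).

Definition cons_point (p : measurableTypeR R * torus R n) : torus R n.+1 :=
  [the n.+1.-tuple (measurableTypeR R) of p.1 :: p.2].

Lemma measurable_cons_point : measurable_fun setT cons_point.
Proof. exact: measurable_cons. Qed.

Context (m : {finite_measure set (torus R n) -> \bar R}).

(** The product of [circle_measure] and [m], transported to tuples. *)
Definition circle_times : set (torus R n.+1) -> \bar R :=
  pushforward (@circle_measure R \x m)%E cons_point.

Let nu : {measure set (torus R n.+1) -> \bar R} :=
  measure_function_pushforward__canonical__measure_function_Measure
    (@circle_measure R \x m)%E measurable_cons_point.

HB.instance Definition _ := Measure.copy circle_times nu.

Lemma circle_times_fin : fin_num_fun circle_times.
Proof.
move=> A mA; rewrite ge0_fin_numE//.
have mA' : measurable (cons_point @^-1` A).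
  by rewrite -[X in measurable X]setTI; exact: measurable_cons_point.
apply: (@le_lt_trans _ _ ((@circle_measure R \x m)%E (setT `*` setT))).
  by rewrite setXTT; apply: (@le_measure _ _ _ (@circle_measure R \x m)%E); rewrite ?inE.
by rewrite product_measure1E// lte_mul_pinfty ?ltry ?fin_num_measure//;
  rewrite -ge0_fin_numE// fin_num_measure.
Qed.

HB.instance Definition _ := Measure_isFinite.Build _ _ _ circle_times
  circle_times_fin.

End circle_times.

Fixpoint torus_measure (R : realType) (n : nat) :
    {finite_measure set (torus R n) -> \bar R} :=
  match n with
  | 0 => \d_([tuple] : torus R 0)
  | m.+1 => circle_times (torus_measure R m)
  end.

Section fourier.
Context (R : realType) (n : nat).
Implicit Types (x : torus R n) (f g : torus R n -> R[i]) (k : 'rV[int]_n).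

Definition translate x (i : 'I_n) (a : R) : torus R n :=
  [tuple (tnth x j + (if j == i then a else 0) : measurableTypeR R) | j < n].

Definition periodic f : Prop :=
  forall x i, f (translate x i (2 * pi)) = f x.

Definition L2norm f : \bar R :=
  Lnorm (torus_measure R n) 2%:E (fun x => (Normc.normc (f x))%:E).

Definition L2torus f : Prop :=
  [/\ periodic f,
      measurable_fun setT (fun x => complex.Re (f x)),
      measurable_fun setT (fun x => complex.Im (f x))
    & (L2norm f < +oo)%E].

Definition torus_integral f : R[i] :=
  Complex (\int[torus_measure R n]_x complex.Re (f x))%R
          (\int[torus_measure R n]_x complex.Im (f x))%R.

Definition expi (a : R) : R[i] := Complex (cos a) (sin a).

Definition pairing k x : R := \sum_(i < n) (k 0 i)%:~R * tnth x i.

Definition fourier_coef f k : R[i] :=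
  (((2 * pi) ^+ n)^-1)%:C%C *
  torus_integral (fun x => f x * expi (- pairing k x)).

Definition real_point k : 'rV[R]_n := map_mx intr k.

(* The canonical norm of ['rV[R]_n] is the sup norm. *)
Definition euclidean_norm (xi : 'rV[R]_n) : R :=
  Num.sqrt (\sum_(i < n) xi 0 i ^+ 2).

(** The frequency ranges: [N, 2N) for N = 2, 4, 8, ..., but [0, 2) for N = 1. *)
Definition frequency_range (N : nat) : set R :=
  [set r | if N == 1%N then 0 <= r < 2 else N%:R <= r < 2 * N%:R].

Definition frequencies (N : nat) : set 'rV[int]_n :=
  [set k | frequency_range N (euclidean_norm (real_point k))].

(** P_N f has finitely many nonzero Fourier coefficients, so it is the
    trigonometric polynomial with these coefficients. *)
Definition freq_proj (N : nat) f : torus R n -> R[i] :=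
  fun x => \sum_(k \in frequencies N) fourier_coef f k * expi (pairing k x).

(** [is_propagated phi t f g]: g is (a representative of) e^{it phi(nabla/i)} f
    in L^2(T^n), i.e. the L^2 function with Fourier coefficients
    e^{it phi(k)} f^(k); it exists for f in L^2 by Parseval and Riesz-Fischer. *)
Definition is_propagated (phi : 'rV[R]_n -> R) (t : R) f g : Prop :=
  L2torus g /\
  forall k, fourier_coef g k =
            expi (t * phi (real_point k)) * fourier_coef f k.

(** Norm of L^2_t([0, T], L^2(T^n)). *)
Definition L2L2norm (T : R) (F : R -> torus R n -> R[i]) : \bar R :=
  Lnorm (mrestr (@lebesgue_measure R) (measurable_itv `[0, T])) 2%:E
    (fun t => L2norm (F t)).

End fourier.

(* So the sum in [freq_proj] is a genuine one: sums over infinite supports are 0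
   by convention. *)
Lemma finite_frequencies (R : realType) (n N : nat) :
  finite_set (@frequencies R n N).
Proof.
pose M := (2 * N).+2.
pose F (s : {ffun 'I_n -> 'I_(M + M)}) : 'rV[int]_n :=
  \row_i ((s i : nat)%:Z - M%:Z).
apply: (@sub_finite_set _ _ (F @` setT)); last first.
  by apply: finite_image; exact: finite_finset.
move=> k; rewrite /frequencies /frequency_range /= => kN.
have kM : euclidean_norm (real_point R k) < M%:R.
  move: kN; rewrite /M; case: ifP => [_|_] /andP[_] /lt_le_trans; apply.
    by rewrite (ler_nat _ 2).
  by rewrite -natrM ler_nat; lia.
have bnd i : (`|k 0 i| < M%:Z)%R.
  rewrite -(ltr_int R); apply: le_lt_trans kM.
  rewrite intr_norm -sqrtr_sqr /euclidean_norm ler_sqrt; last first.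
    by apply: sumr_ge0 => j _; exact: sqr_ge0.
  rewrite (bigD1 i)//= mxE lerDl.
  by apply: sumr_ge0 => j _; exact: sqr_ge0.
have lt i : (`|(k 0 i + M%:Z)%R|%N < M + M)%N.
  by have := bnd i; lia.
exists [ffun i => Ordinal (lt i)] => //.
by apply/rowP => i; rewrite !mxE ffunE /=; have := bnd i; lia.
Qed.

Section dispersion.
Context (R : realType) (n : nat).
Implicit Types (phi : 'rV[R]_n -> R) (xi : 'rV[R]_n).

Definition sim (C a b : R) : Prop := a <= C * b /\ b <= C * a.

Definition basis_vector (i : 'I_n) : 'rV[R]_n := delta_mx 0 i.

Definition partial (i : 'I_n) phi : 'rV[R]_n -> R :=
  fun xi => 'D_(basis_vector i) phi xi.

(** C^infinity: all iterated partial derivatives exist and are continuous. *)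
Definition smooth phi : Prop :=
  forall s : seq 'I_n,
    continuous (foldr partial phi s) /\
    forall (i : 'I_n) xi, derivable (foldr partial phi s) xi (basis_vector i).

Definition grad phi xi : 'rV[R]_n := \row_i partial i phi xi.

(** Sizes are compared through absolute values, mu being allowed to be negative
    (as for mu(x) = - x^2 or mu(x) = x^3). *)
Definition slowly_varying (mu : R -> R) : Prop :=
  exists2 C : R, 0 < C & forall x : R, x != 0 -> sim C `|mu x| `|mu (2 * x)|.

Definition sum_type phi : Prop :=
  exists2 mu : R -> R, slowly_varying mu &
    forall xi, phi xi = \sum_(i < n) mu (xi 0 i).

Definition gradient_growth (alpha : R) phi : Prop :=
  exists2 C : R, 0 < C &
    forall (j : nat) xi, let N : R := 2 ^+ j in
      N <= euclidean_norm xi < 2 * N ->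
      sim C (euclidean_norm (grad phi xi)) (N `^ (alpha - 1)).

End dispersion.

(* Main.v *)
Require Import Defs.
From mathcomp Require Import all_boot all_order all_algebra.
From mathcomp Require Import all_classical all_reals all_analysis.
From mathcomp Require Import measurable_realfun complex zify ring lra.
Set Implicit Arguments.
Unset Strict Implicit.
Unset Printing Implicit Defensive.
Import Order.TTheory GRing.Theory Num.Theory.
Import numFieldNormedType.Exports.
Local Open Scope classical_set_scope.
Local Open Scope ring_scope.

(** Write a and b for the Fourier coefficients of u1 and u2.  The product of the
    two projected solutions is a trigonometric polynomial in x, whose
    coefficient at frequency m is, at time t,
      D_m(t) = sum over l of a(m - l) b(l) e^{it (phi(m - l) + phi(l))},
    with |l| < 2K and N <= |m - l| < 2N.  By Parseval ([parseval]) it suffices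
    to bound, for every fixed m, the integral of |D_m|^2 over [0, N^{1-alpha}]
    by K^{n-1} N^{1-alpha} sum_l |a(m - l) b(l)|^2: summing over m factors the
    right-hand side into the two L^2 norms.

    Restricting the gradient bound to the diagonal (x, ..., x) gives
    |mu'(x)| ~ |x|^{alpha-1} away from 0.  Fix m.  Since |m - l| >= N, some
    coordinate j of m is at least N / sqrt n - O(K) in size, and along the j-th
    coordinate y of l the phase mu(m_j - y) + mu(y) has derivative
    mu'(y) - mu'(m_j - y), of size N^{alpha-1} because the second term
    dominates when K << N ([profile_gap]).  By the mean value theorem the
    phases of two frequencies l, l' that differ only in coordinate j are at
    least delta N^{alpha-1} |l_j - l'_j| apart ([resonance_gap]).  At the time
    scale N^{1-alpha} exponentials with such gaps are almost orthogonal
    ([large_sieve]), and this costs only a constant.  The remaining n - 1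
    coordinates of l take O(K^{n-1}) values, and Cauchy-Schwarz over them
    ([large_sieve_fibers], [size_erase_le]) produces the factor K^{n-1}.

    Almost orthogonality is proved with a polynomial majorant of the indicator
    of [0, T], supported on [-T, 2T] and vanishing to second order at both
    ends.  Two integrations by parts bound its Fourier transform at Delta by
    O(T (T Delta)^{-2}), which is summable over integer separated frequencies;
    Schur's test concludes. *)

(** * Fourier analysis on the torus *)

Lemma integral_mrestr d (T : measurableType d) (R : realType)
    (mu : {measure set T -> \bar R}) (D : set T) (mD : measurable D)
    (f : T -> \bar R) : measurable_fun setT f ->
  (\int[mrestr mu mD]_x f x = \int[mu]_(x in D) f x)%E.
Proof.
move=> mf; have mC : measurable (~` D) by exact: measurableC.
rewrite -(setUv D) integral_setU//; last 2 first.
- by rewrite setUv.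
- by apply/disj_setPCl.
rewrite (eq_measure_integral mu); last first.
  by move=> A mA AD; rewrite /= /mrestr setIidl.
rewrite [X in (_ + X)%E](eq_measure_integral mzero); last first.
  move=> A mA AD; rewrite /= /mrestr (_ : A `&` D = set0) ?measure0//.
  exact/disjoints_subset.
by rewrite integral_measure_zero adde0.
Qed.

Lemma integral_derive (R : realType) (F f : R -> R) (a b : R) : a < b ->
  continuous f -> (forall x : R, is_derive x 1 F (f x)) ->
  (\int[lebesgue_measure]_(x in `[a, b]) (f x)%:E = (F b - F a)%:E)%E.
Proof.
move=> ab cf dF.
have dr x : derivable F x 1 by have := dF x; case.
have cF : continuous F.
  by move=> x; apply/differentiable_continuous/derivable1_diffP.
rewrite EFinB; apply: continuous_FTC2 => //.
- exact: continuous_subspaceT.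
- split=> // [|]; [exact: cvg_at_right_filter (cF a)|exact: cvg_at_left_filter (cF b)].
- by move=> x _; rewrite derive1E; have := dF x; case.
Qed.

Lemma circle_integral_cos (R : realType) (k : int) (th : R) :
  (\int[@circle_measure R]_x (cos (k%:~R * x + th))%:E =
     ((if k == 0 then 2 * pi else 0) * cos th)%:E)%E.
Proof.
have mcos : measurable_fun setT (fun x : R => (cos (k%:~R * x + th))%:E).
  apply/measurable_EFinP; apply: continuous_measurable_fun => x.
  apply: continuous_comp; last exact: continuous_cos.
  apply: cvgD; last exact: cvg_cst.
  by apply: cvgM; [exact: cvg_cst|exact: cvg_id].
rewrite /circle_measure integral_mrestr//.
rewrite integral_itv_bndo_bndc; last first.
  by apply: measurable_funTS; exact: mcos.
have pi2 : 0 < 2 * pi :> R by rewrite mulr_gt0// pi_gt0.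
have cc : continuous (fun x : R => cos (k%:~R * x + th)).
  move=> x; apply: continuous_comp; last exact: continuous_cos.
  apply: cvgD; last exact: cvg_cst.
  by apply: cvgM; [exact: cvg_cst|exact: cvg_id].
have [->|k0] := eqVneq k 0.
  under eq_integral do rewrite mul0r add0r.
  rewrite integral_cst//= lebesgue_measure_itv/= lte_fin pi2 oppr0 adde0.
  by rewrite -EFinM mulrC.
have k0R : k%:~R != 0 :> R by rewrite intr_eq0.
have dF (x : R) : is_derive x 1 (fun x => sin (k%:~R * x + th) / k%:~R)
    (cos (k%:~R * x + th)).
  apply: is_derive_eq.
  rewrite /GRing.scale/= ?mulr1. by field.
rewrite (integral_derive pi2 cc dF).
rewrite mulr0 add0r mul0r; congr (_%:E).
have -> : sin (k%:~R * (2 * pi) + th) = sin th :> R.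
  have P (m : nat) (x : R) : sin (m%:R * (2 * pi) + x) = sin x.
    elim: m x => [|m IH] x; first by rewrite mul0r add0r.
    by rewrite -natr1 mulrDl mul1r -addrA IH addrC mulr_natl sinD2pi.
  case: (k) => m; first exact: P.
  rewrite NegzE rmorphN mulNr /=.
  by rewrite -(P m.+1 (_ + _)) addrA subrr add0r.
by rewrite subrr.
Qed.

Lemma measurable_pairing (R : realType) n (k : 'rV[int]_n) :
  measurable_fun setT (fun x : torus R n => pairing k x : measurableTypeR R).
Proof.
apply: measurable_sum => i.
apply: measurable_funM; [exact: measurable_cst|exact: measurable_tnth].
Qed.

Lemma measurable_cos_pairing (R : realType) n (k : 'rV[int]_n) (th : R) :
  measurable_fun setT (fun x : torus R n => cos (pairing k x + th)).
Proof.
apply: (@measurableT_comp _ _ _ _ _ _ (@cos R)).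
  exact: continuous_measurable_fun (@continuous_cos R).
by apply: measurable_funD; [exact: measurable_pairing|exact: measurable_cst].
Qed.

Lemma cos_bounded (R : realType) T (g : T -> R) (A : set T) :
  [bounded cos (g x) | x in A].
Proof.
exists 1; split; first exact: num_real.
move=> M M1 x _ /=; apply: le_trans (ltW M1).
by rewrite ler_norml cos_geN1 cos_le1.
Qed.

Lemma integrable_cos_pairing (R : realType) n (k : 'rV[int]_n) (th : R) :
  (torus_measure R n).-integrable setT
    (fun x => (cos (pairing k x + th))%:E).
Proof.
apply: measurable_bounded_integrable => //.
- by rewrite -ge0_fin_numE// fin_num_measure.
- exact: measurable_cos_pairing.
- exact: cos_bounded.
Qed.

Lemma pairing_cons (R : realType) n (k : 'rV[int]_n.+1)
    (p : measurableTypeR R * torus R n) :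
  pairing k (cons_point p) =
  (k 0 ord0)%:~R * p.1 + pairing (\row_j k 0 (lift ord0 j)) p.2.
Proof.
rewrite /pairing big_ord_recl /cons_point; congr (_ + _).
by apply: eq_bigr => i _; rewrite mxE tnthS.
Qed.

(** The phase [th] makes the statement inductive: integrating out one variable
    turns the others into a phase.  With [th = 0] and [th = pi / 2] it contains
    the orthogonality of characters, real and imaginary part. *)
Lemma torus_integral_cos (R : realType) n (k : 'rV[int]_n) (th : R) :
  (\int[torus_measure R n]_x (cos (pairing k x + th))%:E =
     ((if k == 0 then (2 * pi) ^+ n else 0) * cos th)%:E)%E.
Proof.
elim: n k th => [|n IH] k th.
  rewrite integral_dirac//= ?diracT ?mul1e; last first.
    by apply/measurable_EFinP; exact: measurable_cos_pairing.
  by rewrite /pairing big_ord0 add0r expr0 thinmx0 eqxx mul1r.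
pose k' : 'rV[int]_n := \row_j k 0 (lift ord0 j).
have k0E : (k == 0) = (k 0 ord0 == 0) && (k' == 0).
  apply/eqP/andP => [k00|[/eqP k0 /eqP k'0]].
    split; first by rewrite k00 mxE eqxx.
    by apply/eqP/rowP => j; rewrite mxE k00 !mxE.
  apply/rowP => j; rewrite mxE; case: (unliftP ord0 j) => [i ->|-> //].
  by move/rowP: k'0 => /(_ i); rewrite !mxE.
pose f (p : measurableTypeR R * torus R n) : \bar R :=
  (cos (pairing k (cons_point p) + th))%:E.
have finT : ((@circle_measure R \x torus_measure R n) setT < +oo)%E.
  rewrite -setXTT product_measure1E// lte_mul_pinfty ?ltry ?fin_num_measure//.
  by rewrite -ge0_fin_numE// fin_num_measure.
have intf : (@circle_measure R \x torus_measure R n)%E.-integrable setT f.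
  apply: measurable_bounded_integrable => //.
  - apply: (@measurableT_comp _ _ _ _ _ _ (fun x => cos (pairing k x + th))).
      exact: measurable_cos_pairing.
    exact: measurable_cons_point.
  - exact: cos_bounded.
transitivity (\int[@circle_measure R \x torus_measure R n]_p f p)%E.
  rewrite /= /circle_times.
  apply: (integral_pushforward (@measurable_cons_point R n)) => //.
  by apply/measurable_EFinP; exact: measurable_cos_pairing.
rewrite -integral21_prod_meas1// /fubini_G /f.
pose c : R := if k 0 ord0 == 0 then 2 * pi else 0.
transitivity (\int[torus_measure R n]_y
    (c%:E * (cos (pairing k' y + th))%:E))%E.
  apply: eq_integral => y _; rewrite -EFinM -circle_integral_cos.
  by apply: eq_integral => x _; rewrite pairing_cons addrA.
rewrite integralZl//; last exact: integrable_cos_pairing.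
rewrite IH -EFinM mulrA /c k0E; congr ((_ * _)%:E).
by case: (k 0 ord0 == 0); case: (k' == 0); rewrite ?mulr0 ?mul0r// exprS.
Qed.

Lemma Lnorm2_EFin d (T : measurableType d) (R : realType)
    (mu : {measure set T -> \bar R}) (f : T -> R) :
  (Lnorm mu 2%:E (fun x => (f x)%:E) =
     (\int[mu]_x (f x ^+ 2)%:E) `^ 2^-1)%E.
Proof.
rewrite unlock; congr (_ `^ _)%E; apply: eq_integral => x _.
by rewrite /= powR_mulrn// real_normK// num_real.
Qed.

Lemma normc_ge0 (R : rcfType) (z : R[i]) : 0 <= Normc.normc z.
Proof. by case: z => a b; exact: sqrtr_ge0. Qed.

Lemma sqr_normcE (R : rcfType) (z : R[i]) :
  Normc.normc z ^+ 2 = complex.Re z ^+ 2 + complex.Im z ^+ 2.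
Proof. by case: z => a b /=; rewrite sqr_sqrtr// addr_ge0// sqr_ge0. Qed.

(** Real and imaginary part of z times the conjugate of w. *)
Definition cross_re (R : rcfType) (z w : R[i]) : R :=
  complex.Re z * complex.Re w + complex.Im z * complex.Im w.

Definition cross_im (R : rcfType) (z w : R[i]) : R :=
  complex.Im z * complex.Re w - complex.Re z * complex.Im w.

Lemma sqr_normc_trig_sum (R : realType) (I : Type) (s : seq I)
    (a : I -> R[i]) (theta : I -> R) :
  Normc.normc (\sum_(k <- s) a k * expi (theta k)) ^+ 2 =
  \sum_(k <- s) \sum_(l <- s)
    (cross_re (a k) (a l) * cos (theta k - theta l)
     - cross_im (a k) (a l) * sin (theta k - theta l)).
Proof.
rewrite sqr_normcE !raddf_sum !expr2 !mulr_suml -big_split/=.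
apply: eq_bigr => k _; rewrite !mulr_sumr -big_split/=.
apply: eq_bigr => l _; rewrite cosB sinB /cross_re /cross_im.
by case: (a k) (a l) => [p q] [p' q'] /=; ring.
Qed.

Lemma norm_cross_trig_le (R : realType) (z w : R[i]) (x : R) :
  `|cross_re z w * cos x - cross_im z w * sin x|
  <= Normc.normc z * Normc.normc w.
Proof.
rewrite -(@ler_pXn2r _ 2) ?nnegrE ?mulr_ge0 ?normc_ge0//.
rewrite exprMn !sqr_normcE real_normK ?num_real// /cross_re /cross_im.
rewrite -subr_ge0; case: z w => [p q] [p' q'] /=.
have := cos2Dsin2 x; set c := cos x; set s := sin x => cs.
have -> : (p ^+ 2 + q ^+ 2) * (p' ^+ 2 + q' ^+ 2) =
  (p ^+ 2 + q ^+ 2) * (p' ^+ 2 + q' ^+ 2) * (c ^+ 2 + s ^+ 2).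
  by rewrite cs mulr1.
set A := (X in 0 <= X).
have -> : A = ((p * p' + q * q') * s + (q * p' - p * q') * c) ^+ 2.
  by rewrite /A; ring.
exact: sqr_ge0.
Qed.

(** Only the diagonal terms of the expanded square survive integration. *)
Lemma parseval (R : realType) n (s : seq 'rV[int]_n) (a : 'rV[int]_n -> R[i]) :
  uniq s ->
  L2norm (fun x : torus R n => \sum_(k <- s) a k * expi (pairing k x)) =
  (Num.sqrt ((2 * pi) ^+ n * \sum_(k <- s) Normc.normc (a k) ^+ 2))%:E.
Proof.
move=> us; rewrite /L2norm Lnorm2_EFin.
set I := (\int[_]_x _)%E.
suff -> : I = ((2 * pi) ^+ n * \sum_(k <- s) Normc.normc (a k) ^+ 2)%:E.
  rewrite poweR_EFin powR12_sqrt// mulr_ge0//.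
    by rewrite exprn_ge0// mulr_ge0// pi_ge0.
  by apply: sumr_ge0 => k _; exact: sqr_ge0.
pose t k l (x : torus R n) : \bar R :=
  ((cross_re (a k) (a l))%:E * (cos (pairing (k - l) x + 0))%:E
   + (cross_im (a k) (a l))%:E * (cos (pairing (k - l) x + pi / 2))%:E)%E.
have intt k l : (torus_measure R n).-integrable setT (t k l).
  by apply: integrableD => //; apply: integrableZl => //;
    exact: integrable_cos_pairing.
transitivity (\int[torus_measure R n]_x
    (\sum_(k <- s) (\sum_(l <- s) t k l x)%R)%R)%E.
  apply: eq_integral => x _; rewrite sqr_normc_trig_sum -sumEFin.
  apply: eq_bigr => k _; rewrite -sumEFin; apply: eq_bigr => l _.
  rewrite /t -!EFinM -EFinD cosDpihalf addr0 mulrN.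
  have -> // : pairing (k - l) x = pairing k x - pairing l x.
  rewrite /pairing -sumrB; apply: eq_bigr => i _.
  by rewrite !mxE intrD rmorphN mulrBl.
rewrite integral_sum//; last first.
  by move=> k; apply: integrable_sum => // l _; exact: intt.
rewrite mulr_sumr -sumEFin; apply: eq_big_seq => k ks.
rewrite integral_sum// (bigD1_seq k)//= big1_seq ?adde0.
  rewrite integralD ?integralZl//; do ?[by
    apply: integrableZl => //; exact: integrable_cos_pairing|exact: integrable_cos_pairing].
  rewrite !torus_integral_cos subrr eqxx cos0 cos_pihalf mulr1 mulr0 mule0 adde0.
  by rewrite -EFinM sqr_normcE /cross_re -!expr2 mulrC.
move=> l /andP[lk _].
rewrite integralD ?integralZl//; do ?[by
    apply: integrableZl => //; exact: integrable_cos_pairing|exact: integrable_cos_pairing].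
by rewrite !torus_integral_cos subr_eq0 eq_sym (negbTE lk) !mul0r !mule0 adde0.
Qed.

(** * Almost orthogonality of separated exponentials in time *)

(** A majorant of the indicator of [0, T].  The square makes the function and
    its derivative [bump'] vanish at -T and 2T, so that two integrations by
    parts over [-T, 2T] produce no boundary terms. *)
Definition bump (R : realType) (T t : R) : R :=
  ((t + T) * (2 * T - t)) ^+ 2 / (4 * T ^+ 4).

Definition bump' (R : realType) (T t : R) : R :=
  (t + T) * (2 * T - t) * (T - 2 * t) / (2 * T ^+ 4).

Definition bump'' (R : realType) (T t : R) : R :=
  ((T - 2 * t) ^+ 2 - 2 * ((t + T) * (2 * T - t))) / (2 * T ^+ 4).

Lemma bump_ge0 (R : realType) (T t : R) : 0 < T -> 0 <= bump T t.
Proof. by move=> T0; rewrite divr_ge0 ?sqr_ge0// mulr_ge0// exprn_ge0// ltW. Qed.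

Lemma bump_ge1 (R : realType) (T t : R) : 0 < T -> 0 <= t <= T -> 1 <= bump T t.
Proof.
move=> T0 /andP[t0 tT]; rewrite ler_pdivlMr ?mulr_gt0 ?exprn_gt0// mul1r.
have -> : 4 * T ^+ 4 = (2 * T ^+ 2) ^+ 2 by ring.
have A0 : 0 <= (t + T) * (2 * T - t) by rewrite mulr_ge0//; lra.
have B0 : 0 <= 2 * T ^+ 2 by rewrite mulr_ge0// exprn_ge0// ltW.
by rewrite ler_pXn2r ?nnegrE//; nra.
Qed.

Lemma bump_le2 (R : realType) (T t : R) : 0 < T -> - T <= t <= 2 * T ->
  bump T t <= 2.
Proof.
move=> T0 /andP[t0 tT]; rewrite ler_pdivrMr ?mulr_gt0 ?exprn_gt0//.
have -> : 2 * (4 * T ^+ 4) = 2 * (2 * T ^+ 2) ^+ 2 by ring.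
have A0 : 0 <= (t + T) * (2 * T - t) by rewrite mulr_ge0//; lra.
have A1 : (t + T) * (2 * T - t) <= 9 / 4 * T ^+ 2.
  by have := sqr_ge0 (t - T / 2); nra.
have T2 : 0 < T ^+ 2 by rewrite exprn_gt0.
by move: A0 A1 T2; set A := (t + T) * _; set B := T ^+ 2 => *; nra.
Qed.

Lemma norm_bump''_le (R : realType) (T t : R) : 0 < T -> - T <= t <= 2 * T ->
  `|bump'' T t| <= 9 / 2 / T ^+ 2.
Proof.
move=> T0 /andP[t0 tT].
have T4 : 0 < 2 * T ^+ 4 by rewrite mulr_gt0 ?exprn_gt0.
rewrite normrM (gtr0_norm (x := _^-1)) ?invr_gt0// ler_pdivrMr//.
have -> : 9 / 2 / T ^+ 2 * (2 * T ^+ 4) = 9 * T ^+ 2 by field; rewrite gt_eqF.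
have A0 : 0 <= (t + T) * (2 * T - t) by rewrite mulr_ge0//; lra.
have := sqr_ge0 (T - 2 * t) => y0.
have -> : (T - 2 * t) ^+ 2 = 9 * T ^+ 2 - 4 * ((t + T) * (2 * T - t)) by ring.
have A1 : 4 * ((t + T) * (2 * T - t)) <= 9 * T ^+ 2.
  rewrite -subr_ge0; apply: le_trans y0 _.
  by rewrite le_eqVlt; apply/orP; left; apply/eqP; ring.
by rewrite ler_norml; apply/andP; split; lra.
Qed.

Definition oscillation (R : realType) (p q Delta t : R) : R :=
  p * cos (t * Delta) - q * sin (t * Delta).

(** With h the oscillation and g = - h / Delta^2, so that g'' = h, this is
    bump g' - bump' g: its derivative is bump h - bump'' g, the antiderivative
    behind integrating by parts twice.  Division by 0 being 0, it vanishes
    for Delta = 0, where nothing oscillates. *)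
Definition bump_primitive (R : realType) (T p q Delta t : R) : R :=
  bump T t * ((p * sin (t * Delta) + q * cos (t * Delta)) * Delta^-1)
  + bump' T t * (oscillation p q Delta t * Delta^-1 ^+ 2).

Definition bump_density (R : realType) (T p q Delta t : R) : R :=
  if Delta == 0 then 0 else
  bump T t * oscillation p q Delta t
  + bump'' T t * oscillation p q Delta t * Delta^-1 ^+ 2.

Lemma is_derive_bump (R : realType) (T t : R) : 0 < T ->
  is_derive t 1 (bump T) (bump' T t).
Proof.
move=> T0; rewrite /bump; apply: is_derive_eq; rewrite /GRing.scale/= /bump'.
by field; rewrite gt_eqF.
Qed.

Lemma is_derive_bump' (R : realType) (T t : R) : 0 < T ->
  is_derive t 1 (bump' T) (bump'' T t).
Proof.
move=> T0; rewrite /bump'; apply: is_derive_eq; rewrite /GRing.scale/= /bump''.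
by field; rewrite gt_eqF.
Qed.

Lemma is_derive_bump_primitive (R : realType) (T p q Delta t : R) : 0 < T ->
  is_derive t 1 (bump_primitive T p q Delta) (bump_density T p q Delta t).
Proof.
move=> T0; have := is_derive_bump t T0; have := is_derive_bump' t T0 => dB' dB.
rewrite /bump_density; case: eqVneq => [->|D0].
  rewrite (_ : bump_primitive _ _ _ _ = cst 0); first exact: is_derive_cst.
  by apply/funext => x; rewrite /bump_primitive invr0 expr0n/= !mulr0 addr0.
rewrite /bump_primitive /oscillation; apply: is_derive_eq.
by rewrite /GRing.scale/=; field.
Qed.

Lemma continuous_is_derive (R : realType) (f f' : R -> R) :
  (forall t : R, is_derive t 1 f (f' t)) -> continuous f.
Proof.
move=> df t; apply/differentiable_continuous/derivable1_diffP.
by have := df t; case.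
Qed.

Lemma is_derive_big (R : realType) (I : Type) (s : seq I)
    (F f : I -> R -> R) (t : R) :
  (forall i, is_derive t 1 (F i) (f i t)) ->
  is_derive t 1 (fun t => \sum_(i <- s) F i t) (\sum_(i <- s) f i t).
Proof.
move=> dF; elim: s => [|i s IH].
  rewrite big_nil (_ : (fun _ => _) = cst 0); first exact: is_derive_cst.
  by apply/funext => x; rewrite big_nil.
rewrite big_cons (_ : (fun _ => _) = F i \+ (fun t => \sum_(j <- s) F j t)).
  exact: is_deriveD.
by apply/funext => x; rewrite big_cons.
Qed.

Lemma continuous_big (R : realType) (I : Type) (s : seq I) (f : I -> R -> R) :
  (forall i, continuous (f i)) -> continuous (fun t => \sum_(i <- s) f i t).
Proof.
move=> cf; elim: s => [|i s IH] t.
  rewrite (_ : (fun _ => _) = cst 0); first exact: cvg_cst.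
  by apply/funext => x; rewrite big_nil.
rewrite (_ : (fun _ => _) = f i \+ (fun t => \sum_(j <- s) f j t)).
  by apply: cvgD; [exact: cf|exact: IH].
by apply/funext => x; rewrite big_cons.
Qed.

Lemma continuous_oscillation (R : realType) (p q Delta : R) :
  continuous (oscillation p q Delta).
Proof.
apply: (@continuous_is_derive _ _
  (fun t => - (p * sin (t * Delta) + q * cos (t * Delta)) * Delta)) => t.
by apply: is_derive_eq; rewrite /GRing.scale/=; ring.
Qed.

Lemma continuous_bump_density (R : realType) (T p q Delta : R) : 0 < T ->
  continuous (bump_density T p q Delta).
Proof.
move=> T0; rewrite /bump_density; case: eqVneq => [_ t|_ t]; first exact: cvg_cst.
have cB : continuous (bump T).
  by apply: (@continuous_is_derive _ _ (bump' T)) => x; exact: is_derive_bump.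
have cB'' : continuous (bump'' T).
  apply: (@continuous_is_derive _ _ (fun t => - (6 * (T - 2 * t)) / (2 * T ^+ 4))).
  move=> x; rewrite /bump''; apply: is_derive_eq; rewrite /GRing.scale/=.
  by field; rewrite gt_eqF.
have cO := @continuous_oscillation _ p q Delta.
apply: cvgD; first by apply: cvgM; [exact: cB|exact: cO].
by apply: cvgM; [apply: cvgM; [exact: cB''|exact: cO]|exact: cvg_cst].
Qed.

Lemma bump_primitive_end (R : realType) (T p q Delta : R) :
  bump_primitive T p q Delta (2 * T) - bump_primitive T p q Delta (- T) = 0.
Proof.
rewrite /bump_primitive /bump /bump' addNr subrr.
by rewrite !(mulr0, mul0r, expr0n, addr0, subrr)/= ?mul0r ?subrr.
Qed.

(** A pointwise form of the decay of the Fourier transform of the bump: up to a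
    derivative with zero integral, the weighted oscillation is
    O((T Delta)^{-2}).  Working pointwise leaves a single integral for the whole
    double sum. *)
Lemma bump_oscillation_le (R : realType) (T Delta t : R) (z w : R[i]) : 0 < T ->
  - T <= t <= 2 * T ->
  bump T t * oscillation (cross_re z w) (cross_im z w) Delta t <=
  bump_density T (cross_re z w) (cross_im z w) Delta t +
  Normc.normc z * Normc.normc w *
    (if Delta == 0 then 2 else 9 / 2 / (T * Delta) ^+ 2).
Proof.
move=> T0 tT; set p := cross_re _ _; set q := cross_im _ _.
set M := Normc.normc z * _.
have oM : `|oscillation p q Delta t| <= M by exact: norm_cross_trig_le.
have M0 : 0 <= M by rewrite mulr_ge0// normc_ge0.
rewrite /bump_density; case: eqVneq => [D0|D0].
  rewrite add0r; apply: le_trans (ler_wpM2l (bump_ge0 t T0) _) _.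
    exact: le_trans (ler_norm _) oM.
  by rewrite mulrC ler_wpM2l// bump_le2.
rewrite -addrA lerDl -lerBlDl sub0r.
apply: le_trans (ler_norm _) _; rewrite normrN normrM (ger0_norm (sqr_ge0 _)) normrM.
rewrite (_ : M * _ = 9 / 2 / T ^+ 2 * M * (Delta^-1) ^+ 2); last first.
  by field; rewrite D0 gt_eqF.
rewrite ler_wpM2r ?sqr_ge0//.
by rewrite ler_pM// norm_bump''_le.
Qed.

(** The terms are dominated by the telescoping 4 / (m + 1) - 4 / (m + 2). *)
Lemma sum_inv_sqr_nat (R : realType) (s : seq nat) : uniq s ->
  \sum_(m <- s) (1 + m%:R ^+ 2)^-1 <= 4 :> R.
Proof.
move=> us; pose M := (\max_(m <- s) m).+1.
have sM : {subset s <= iota 0 M}.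
  by move=> m ms; rewrite mem_iota add0n ltnS; apply: leq_bigmax_seq.
have E : perm_eq s [seq m <- iota 0 M | m \in s].
  apply: uniq_perm => //; first by rewrite filter_uniq// iota_uniq.
  by move=> m; rewrite mem_filter; case: (boolP (m \in s)) => //= /sM ->.
rewrite (perm_big _ E) big_filter.
apply: (@le_trans _ _ (\sum_(m <- iota 0 M) (1 + m%:R ^+ 2)^-1)).
  by rewrite big_mkcond; apply: ler_sum => m _; case: ifP.
(* The partial sum of the telescoping majorant. *)
apply: (@le_trans _ _ (4 - 4 / M.+1%:R)); last by rewrite gerBl divr_ge0.
elim: M {sM E} => [|M IH]; first by rewrite big_nil divr1 subrr.
rewrite -[M.+1]addn1 iotaD big_cat/= big_seq1 add0n addn1.
apply: le_trans (lerD IH (lexx _)) _.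
rewrite -[M.+2%:R]natr1 -[M.+1%:R]natr1; set x : R := M%:R.
have x0 : 0 <= x by exact: ler0n.
rewrite -subr_ge0.
have -> : 4 - 4 / (x + 1 + 1) - (4 - 4 / (x + 1) + (1 + x ^+ 2)^-1) =
  (3 * x ^+ 2 - 3 * x + 2) / ((x + 1 + 1) * (x + 1) * (1 + x ^+ 2)).
  by field; rewrite !gt_eqF//; nra.
by apply: divr_ge0; nra.
Qed.

Lemma sum_inv_sqr_int (R : realType) (s : seq int) : uniq s ->
  \sum_(m <- s) (1 + m%:~R ^+ 2)^-1 <= 8 :> R.
Proof.
move=> us; rewrite (bigID (fun m => 0 <= m))/=.
have -> : 8 = 4 + 4 :> R by ring.
have H (P : pred int) : {in P &, injective absz} ->
  \sum_(m <- s | P m) (1 + m%:~R ^+ 2)^-1 <= 4 :> R.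
  move=> Pinj; rewrite -big_filter.
  have -> : \sum_(m <- [seq m <- s | P m]) (1 + m%:~R ^+ 2)^-1 =
     \sum_(m <- [seq absz m | m <- [seq m <- s | P m]]) (1 + m%:R ^+ 2)^-1 :> R.
    rewrite big_map; apply: eq_bigr => m _; congr (_ + _)^-1.
    by rewrite [`|m|%:R]pmulrn abszE intr_norm real_normK// num_real.
  apply: sum_inv_sqr_nat; rewrite map_inj_in_uniq ?filter_uniq//.
  by move=> x y; rewrite !mem_filter => /andP[Px _] /andP[Py _]; exact: Pinj.
by apply: lerD; apply: H => x y; rewrite -!topredE /=; lia.
Qed.

(** Schur's test: replace x_k x_l by (x_k^2 + x_l^2) / 2 and use the symmetry of
    the kernel. *)
Lemma schur_sum_le (R : realType) (I : eqType) (s : seq I) (x : I -> R)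
    (b : I -> I -> R) (B : R) : (forall k l, 0 <= b k l) ->
  (forall k l, b k l = b l k) ->
  (forall k, k \in s -> \sum_(l <- s) b k l <= B) ->
  \sum_(k <- s) \sum_(l <- s) x k * x l * b k l <= B * \sum_(k <- s) x k ^+ 2.
Proof.
move=> b0 bC bB.
pose S := \sum_(k <- s) \sum_(l <- s) x k ^+ 2 * b k l.
have S' : S = \sum_(k <- s) \sum_(l <- s) x l ^+ 2 * b k l.
  rewrite /S exchange_big; apply: eq_bigr => k _; apply: eq_bigr => l _.
  by rewrite bC.
have SB : S <= B * \sum_(k <- s) x k ^+ 2.
  rewrite mulr_sumr /S big_seq [leRHS]big_seq; apply: ler_sum => k ks.
  by rewrite -mulr_sumr mulrC ler_wpM2r ?sqr_ge0// bB.
apply: le_trans SB; rewrite -(ler_pM2l (ltr0n R 2)).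
rewrite [2 * S]mulr_natl mulr2n [X in _ <= _ + X]S' /S -big_split/= mulr_sumr.
apply: ler_sum => k _; rewrite -big_split/= mulr_sumr; apply: ler_sum => l _.
by have := b0 k l; have := sqr_ge0 (x k - x l); nra.
Qed.

(** A mean value theorem of Montgomery-Vaughan type.  The integers [d] label the
    frequencies, whose gaps in units of 1/T are at least delta times those of
    the labels.  Expand the square against the bump: the pair (k, l) contributes
    O(1 / (delta^2 (1 + (d k - d l)^2))), a kernel with bounded row sums. *)
Lemma large_sieve (R : realType) (I : eqType) (s : seq I) (c : I -> R[i])
    (omega : I -> R) (d : I -> int) (T delta : R) :
  0 < T -> 0 < delta <= 1 -> uniq s -> {in s &, injective d} ->
  (forall k l, k \in s -> l \in s ->
     delta * `|d k - d l|%:~R <= T * `|omega k - omega l|) ->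
  (\int[lebesgue_measure]_(t in `[0%R, T])
     (Normc.normc (\sum_(k <- s) c k * expi (t * omega k)) ^+ 2)%:E
   <= (216 / delta ^+ 2 * T * \sum_(k <- s) Normc.normc (c k) ^+ 2)%:E)%E.
Proof.
move=> T0 /andP[delta0 delta1] us dinj gap.
pose D k l := omega k - omega l.
pose f k l := oscillation (cross_re (c k) (c l)) (cross_im (c k) (c l)) (D k l).
pose F t := \sum_(k <- s) \sum_(l <- s) f k l t.
have FE t : Normc.normc (\sum_(k <- s) c k * expi (t * omega k)) ^+ 2 = F t.
  rewrite sqr_normc_trig_sum; apply: eq_bigr => k _; apply: eq_bigr => l _.
  by rewrite /f /oscillation /D mulrBr.
have F0 t : 0 <= F t by rewrite -FE sqr_ge0.
have cF : continuous F.
  by do 2 apply: continuous_big => ?; exact: continuous_oscillation.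
pose Q := \sum_(k <- s) Normc.normc (c k) ^+ 2.
(* 72 = 9 * 8, the kernel constant times the bound of sum_inv_sqr_int; the
   length 3T of [-T, 2T] turns it into 216. *)
pose B := 72 / delta ^+ 2 * Q.
pose g k l t := bump_density T (cross_re (c k) (c l)) (cross_im (c k) (c l)) (D k l) t.
pose Phi t := (\sum_(k <- s) \sum_(l <- s) g k l t) + B.
pose prim t := (\sum_(k <- s) \sum_(l <- s)
   bump_primitive T (cross_re (c k) (c l)) (cross_im (c k) (c l)) (D k l) t) + B * t.
have cPhi : continuous Phi.
  move=> t; apply: cvgD; last exact: cvg_cst.
  by apply: continuous_big => k; apply: continuous_big => l;
    exact: continuous_bump_density.
have dprim (t : R) : is_derive t 1 prim (Phi t).
  have dB : is_derive t 1 (fun t : R => B * t) B.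
    by apply: is_derive_eq; rewrite /GRing.scale/= mulr1.
  have dG : is_derive t 1 (fun t : R => \sum_(k <- s) \sum_(l <- s)
      bump_primitive T (cross_re (c k) (c l)) (cross_im (c k) (c l)) (D k l) t)
      (\sum_(k <- s) \sum_(l <- s) g k l t).
    apply: (is_derive_big s (f := fun k t => \sum_(l <- s) g k l t)
      (F := fun k t => \sum_(l <- s) bump_primitive T _ _ (D k l) t)) => k.
    apply: (is_derive_big s (f := g k)) => l.
    exact: is_derive_bump_primitive.
  exact: is_deriveD.
have bFPhi t : - T <= t <= 2 * T -> bump T t * F t <= Phi t.
  move=> tT; pose beta k l : R := 9 / delta ^+ 2 / (1 + (d k - d l)%:~R ^+ 2).
  (* 9 = 2 * (9/2): on the diagonal 1 / (1 + m^2) = 1, off it 1 / m^2 is at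
     most 2 / (1 + m^2). *)
  apply: (@le_trans _ _ (\sum_(k <- s) \sum_(l <- s)
      (g k l t + Normc.normc (c k) * Normc.normc (c l) * beta k l))); last first.
    under eq_bigr do rewrite big_split/=.
    rewrite big_split/= lerD2l; apply: schur_sum_le.
    - move=> k l; rewrite divr_ge0//; first by rewrite divr_ge0// sqr_ge0.
      by rewrite addr_ge0// sqr_ge0.
    - by move=> k l; rewrite /beta -opprB rmorphN sqrrN.
    - move=> k ks; rewrite -mulr_sumr.
      have -> : 72 / delta ^+ 2 = 9 / delta ^+ 2 * 8 by ring.
      rewrite ler_wpM2l//; first by rewrite divr_ge0// sqr_ge0.
      have := @sum_inv_sqr_int R [seq d k - d l | l <- s].
      rewrite big_map; apply.
      rewrite map_inj_in_uniq// => x y xs ys.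
      by move/addrI/oppr_inj; exact: dinj.
  rewrite /F mulr_sumr big_seq [leRHS]big_seq; apply: ler_sum => k ks.
  rewrite mulr_sumr big_seq [leRHS]big_seq; apply: ler_sum => l ls.
  apply: le_trans (bump_oscillation_le _ _ _ T0 tT) _; rewrite lerD2l.
  rewrite ler_wpM2l ?mulr_ge0 ?normc_ge0//.
  have d2 : 0 < delta ^+ 2 by rewrite exprn_gt0.
  have [dkl|dkl] := eqVneq (d k) (d l).
    rewrite (dinj _ _ ks ls dkl) /D subrr eqxx /beta subrr expr0n/= addr0 divr1.
    by rewrite ler_pdivlMr//; have : delta ^+ 2 <= 1 by [rewrite expr_le1// ltW]; lra.
  pose m : R := (d k - d l)%:~R.
  have m1 : 1 <= `|m|.
    by rewrite /m -intr_norm (ler_int _ 1); move: dkl; lia.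
  have := gap _ _ ks ls; rewrite -[omega k - omega l]/(D k l) intr_norm -/m => gap'.
  have TD0 : 0 < T * `|D k l|.
    by apply: lt_le_trans gap'; rewrite mulr_gt0//; lra.
  have D0 : D k l != 0.
    by apply: contraTneq TD0 => ->; rewrite normr0 mulr0 ltxx.
  rewrite (negbTE D0) -/m.
  have TD2 : (T * D k l) ^+ 2 = (T * `|D k l|) ^+ 2.
    by rewrite !exprMn real_normK ?num_real.
  have m2 : 1 <= m ^+ 2 by rewrite -[m ^+ 2]real_normK ?num_real// expr_ge1.
  have g2 : delta ^+ 2 * m ^+ 2 <= (T * D k l) ^+ 2.
    rewrite TD2 -[m ^+ 2]real_normK ?num_real// -exprMn.
    by rewrite ler_pXn2r// nnegrE mulr_ge0// ltW.
  rewrite /beta -/m -2!mulrA -2!invfM ler_pM2l//.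
  have X0 : 0 < (T * D k l) ^+ 2 by rewrite TD2 exprn_gt0.
  by rewrite lef_pV2 ?posrE; nra.
rewrite (_ : (216 / _ * _ * _) = prim (2 * T) - prim (- T)); last first.
  rewrite /prim opprD addrACA -sumrB [X in _ = X + _]big1 ?add0r.
    by rewrite /B -/Q; ring.
  by move=> k _; rewrite -sumrB big1// => l _; exact: bump_primitive_end.
have sub : `[0%R, T] `<=` `[- T, 2 * T]%classic.
  by move=> t /=; rewrite !in_itv/= => /andP[t0 tT]; apply/andP; split; lra.
rewrite -(integral_derive _ cPhi dprim); last by lra.
have mPhi (A : set R) : measurable_fun A (fun t => (Phi t)%:E).
  by apply/measurable_EFinP/measurable_funTS; exact: continuous_measurable_fun.
have Phi0 t : - T <= t <= 2 * T -> 0 <= Phi t.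
  by move=> tT; apply: le_trans (bFPhi t tT); rewrite mulr_ge0// bump_ge0.
apply: (@le_trans _ _ (\int[lebesgue_measure]_(t in `[0%R, T]) (Phi t)%:E)%E).
  apply: ge0_le_integral => //.
  - by move=> t _; rewrite lee_fin sqr_ge0.
  - rewrite (_ : (fun _ => _) = (fun t => (F t)%:E)); last first.
      by apply/funext => t; rewrite FE.
    by apply/measurable_EFinP/measurable_funTS; exact: continuous_measurable_fun.
  - exact: mPhi.
  - move=> t tT; rewrite lee_fin FE; apply: le_trans (bFPhi t (sub t tT)).
    by rewrite ler_peMl// bump_ge1.
by apply: ge0_subset_integral => //; exact: mPhi.
Qed.

(** * Growth of the profile of a sum type dispersion relation *)

Lemma is_derive_coordinate (R : realType) n (f : 'rV[R]_n -> R) (g : R -> R)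
    (i : 'I_n) (xi : 'rV[R]_n) :
  (forall h, f (h *: basis_vector R i + xi) - f xi = g (h + xi 0 i) - g (xi 0 i)) ->
  derivable f xi (basis_vector R i) ->
  is_derive (xi 0 i) 1 g (partial i f xi).
Proof.
move=> fg df.
have E : (fun h => h^-1 *: ((g \o shift (xi 0 i)) (h *: (1 : R)) - g (xi 0 i))) =
         (fun h => h^-1 *: ((f \o shift xi) (h *: basis_vector R i) - f xi)).
  by apply/funext => h; rewrite /= fg scaler1.
split; first by rewrite /derivable E.
by rewrite /partial /derive E.
Qed.

Section sum_type_dispersion.
Context (R : realType) (n : nat) (phi : 'rV[R]_n -> R) (mu : R -> R).
Hypothesis n_gt0 : (0 < n)%N.
Hypothesis phiE : forall xi, phi xi = \sum_(i < n) mu (xi 0 i).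
Hypothesis phi_smooth : smooth phi.

Let i0 : 'I_n := Ordinal n_gt0.
Let dmu x := partial i0 phi (const_mx x).

Lemma is_derive_mu_partial (i : 'I_n) (xi : 'rV[R]_n) :
  is_derive (xi 0 i) 1 mu (partial i phi xi).
Proof.
apply: is_derive_coordinate; last by case: (phi_smooth [::]) => _; exact.
move=> h; rewrite !phiE (bigD1 i)//= [X in _ - X](bigD1 i)//= opprD addrACA.
rewrite !mxE !eqxx mulr1 -sumrB big1 ?addr0// => j ji.
by rewrite !mxE (negbTE ji) andbF mulr0 add0r subrr.
Qed.

Lemma is_derive_mu (x : R) : is_derive x 1 mu (dmu x).
Proof. by have := is_derive_mu_partial i0 (const_mx x); rewrite mxE. Qed.

Lemma partialE (i : 'I_n) (xi : 'rV[R]_n) : partial i phi xi = dmu (xi 0 i).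
Proof.
have [_ <-] := is_derive_mu_partial i xi.
by have [_ ->] := is_derive_mu (xi 0 i).
Qed.

(** Continuity in one variable follows from the existence of the second
    derivative in a coordinate direction. *)
Lemma continuous_dmu : continuous dmu.
Proof.
pose f := partial i0 phi.
apply: (@continuous_is_derive _ _ (fun x => partial i0 f (const_mx x))) => x.
have := @is_derive_coordinate _ _ f dmu i0 (const_mx x).
rewrite mxE; apply; last by case: (phi_smooth [:: i0]) => _; exact.
by move=> h; rewrite /f !partialE !mxE !eqxx mulr1.
Qed.

Lemma euclidean_norm_const (x : R) :
  euclidean_norm (const_mx x : 'rV[R]_n) = Num.sqrt n%:R * `|x|.
Proof.
rewrite /euclidean_norm; under eq_bigr do rewrite mxE.
by rewrite sumr_const card_ord -[x ^+ 2 *+ n]mulr_natl sqrtrM ?ler0n// sqrtr_sqr.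
Qed.

Lemma grad_const (x : R) : grad phi (const_mx x) = const_mx (dmu x).
Proof. by apply/rowP => i; rewrite !mxE partialE mxE. Qed.

End sum_type_dispersion.

Lemma dyadic_between (R : realType) (y : R) : 1 <= y ->
  exists j : nat, 2 ^+ j <= y < 2 * 2 ^+ j.
Proof.
move=> y1; have y0 : 0 <= y by lra.
have m1 : (0 < Num.truncn y)%N by rewrite truncn_gt0.
exists (trunc_log 2 (Num.truncn y)).
have /andP[h1 h2] := truncn_itv y0.
have /andP[h3 h4] := @trunc_log_bounds 2 _ isT m1.
apply/andP; split.
  by apply: le_trans h1; rewrite -natrX ler_nat.
by apply: lt_le_trans h2 _; rewrite -exprS -natrX ler_nat.
Qed.

(** On the diagonal the gradient has n equal entries, and both the point and the
    gradient are sqrt n times longer than their entries. *)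
Lemma sum_type_profile (R : realType) n (phi : 'rV[R]_n -> R) (mu : R -> R)
    (alpha : R) : (0 < n)%N -> smooth phi ->
  (forall xi, phi xi = \sum_(i < n) mu (xi 0 i)) -> gradient_growth alpha phi ->
  exists dmu : R -> R, [/\ forall x : R, is_derive x 1 mu (dmu x), continuous dmu &
    exists2 C : R, 0 < C & forall (j : nat) (x : R),
      2 ^+ j <= Num.sqrt n%:R * `|x| < 2 * 2 ^+ j ->
      sim C (Num.sqrt n%:R * `|dmu x|) ((2 ^+ j) `^ (alpha - 1))].
Proof.
move=> n0 sphi phiE [C C0 growth].
exists (fun x => partial (Ordinal n0) phi (const_mx x)); split.
- by move=> x; exact: is_derive_mu.
- exact: continuous_dmu phiE sphi.
- exists C => // j x; rewrite -!(euclidean_norm_const n) -(grad_const n0 phiE sphi).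
  exact: growth.
Qed.

Lemma bounded_on_unit (R : realType) (f : R -> R) : continuous f ->
  exists2 B : R, 0 <= B & forall y, `|y| <= 1 -> `|f y| <= B.
Proof.
move=> cf; have cnf : continuous (fun y => `|f y|).
  by move=> y; apply: continuous_comp; [exact: cf|exact: norm_continuous].
have [||c _ cB] := @EVT_max _ (fun y => `|f y|) (-1) 1; first by lra.
  exact: continuous_subspaceT.
by exists `|f c| => // y y1; apply: cB; rewrite in_itv/= -ler_norml.
Qed.

(** Both bounds on the derivative hold at dyadic scales away from 0; near 0 it is
    merely bounded, which is enough since K >= 1.  The constant [c] is chosen so
    that the upper bound at scale K is at most half the lower bound at scale N: this
    uses alpha > 1. *)
Lemma profile_gap (R : realType) (dmu : R -> R) (s alpha C : R) :
  1 <= s -> 1 < alpha -> 0 < C -> continuous dmu ->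
  (forall (j : nat) (x : R), 2 ^+ j <= s * `|x| < 2 * 2 ^+ j ->
      sim C (s * `|dmu x|) ((2 ^+ j) `^ (alpha - 1))) ->
  exists c delta : R, [/\ 0 < c, 0 < delta & forall K N x y : R,
    1 <= K -> 2 <= N -> K <= c * N -> N <= 2 * (s * `|x|) -> `|y| <= 2 * K ->
    delta * N `^ (alpha - 1) <= `|dmu x| - `|dmu y|].
Proof.
move=> s1 alpha1 C0 cdmu growth; have [B B0 hB] := bounded_on_unit cdmu.
have {growth} growth x : 1 <= s * `|x| -> exists2 N', s * `|x| / 2 <= N' <= s * `|x| &
    sim C (s * `|dmu x|) (N' `^ (alpha - 1)).
  move=> /dyadic_between[j Nx]; exists (2 ^+ j); last exact: growth.
  by move: Nx => /andP[? ?]; apply/andP; split; lra.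
set b := alpha - 1 in growth *; have b0 : 0 < b by rewrite /b; lra.
(* M bounds the derivative at scale K: s |y| <= 2 s K.  In delta, the factor 4
   is lost since the dyadic scale of x is only known to be at least N / 4. *)
pose M := B + C * (2 * s) `^ b.
pose delta := (4^-1) `^ b / (2 * (C * s)).
have M0 : 0 < M by rewrite /M ltr_wpDl// mulr_gt0// powR_gt0//; lra.
have Cs0 : 0 < C * s by rewrite mulr_gt0//; lra.
have delta0 : 0 < delta by rewrite divr_gt0 ?powR_gt0// mulr_gt0.
exists ((delta / M) `^ b^-1), delta; split => //.
  by rewrite powR_gt0// divr_gt0.
move=> K N x y K1 N2 KN Nx yK.
have low : 2 * delta * N `^ b <= `|dmu x|.
  have [|N' /andP[N'1 _] [_]] := growth x; first by lra.
  move=> h; have : (N / 4) `^ b <= C * (s * `|dmu x|).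
    apply: le_trans h; rewrite ge0_ler_powR ?nnegrE//; lra.
  rewrite powRM//; [|lra..].
  rewrite mulrA /delta => h'; rewrite -(ler_pM2l Cs0).
  rewrite (_ : C * s * _ = N `^ b * 4^-1 `^ b)//.
  by field; rewrite !gt_eqF//; lra.
have KM : M * K `^ b <= delta * N `^ b.
  rewrite -ler_pdivlMl// mulrA [M^-1 * _]mulrC.
  have -> : delta / M = ((delta / M) `^ b^-1) `^ b.
    by rewrite -powRrM mulVf ?powRr1 ?gt_eqF// divr_ge0// ltW.
  rewrite -powRM ?powR_ge0//; last by lra.
  by rewrite ge0_ler_powR ?nnegrE ?(ltW b0)//; lra.
have up : `|dmu y| <= M * K `^ b.
  have Kb : 1 <= K `^ b.
    have -> : 1 = 1 `^ b :> R by rewrite powR1.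
    by rewrite ge0_ler_powR ?nnegrE//; lra.
  have Z : 0 <= C * (2 * s) `^ b by rewrite mulr_ge0 ?powR_ge0// ltW.
  have [sy|sy] := leP 1 (s * `|y|).
    have [N' /andP[N'0 N'1] [h _]] := growth y sy.
    apply: (@le_trans _ _ (s * `|dmu y|)); first by rewrite ler_peMl.
    apply: (le_trans h); rewrite /M mulrDl ler_wpDl ?mulr_ge0 ?powR_ge0//.
    rewrite -mulrA ler_pM2l// -powRM//; [|lra..].
    have N'K : N' <= 2 * s * K.
      by apply: (le_trans N'1); rewrite -mulrA mulrCA ler_wpM2l//; lra.
    by rewrite ge0_ler_powR ?nnegrE ?(ltW b0)//; lra.
  apply: (@le_trans _ _ B); first by apply: hB; nra.
  by rewrite /M; nra.
lra.
Qed.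

(** * Phase gaps and counting at a fixed total frequency *)

(** [X] stands for a coordinate of the total frequency.  The condition on [dmu]
    makes the derivative of y |-> mu (X - y) + mu y at least [D] in absolute
    value on the interval, so the mean value theorem applies. *)
Lemma resonance_gap (R : realType) (mu dmu : R -> R) (D X r : R) :
  (forall x : R, is_derive x 1 mu (dmu x)) ->
  (forall y, `|y| <= r -> D <= `|dmu (X - y)| - `|dmu y|) ->
  forall a b, `|a| <= r -> `|b| <= r ->
    D * `|a - b| <= `|(mu (X - a) + mu a) - (mu (X - b) + mu b)|.
Proof.
move=> mu' gap; suff H a b : a <= b -> `|a| <= r -> `|b| <= r ->
    D * `|a - b| <= `|(mu (X - a) + mu a) - (mu (X - b) + mu b)|.
  move=> a b ar br; have [ab|/ltW ba] := leP a b; first exact: H.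
  by rewrite distrC [leRHS]distrC H.
move=> ab ar br; pose psi y := mu (X - y) + mu y.
have dpsi (y : R) : is_derive y 1 psi (- dmu (X - y) + dmu y).
  have dX : is_derive y 1 (fun y : R => X - y) (- 1).
    by apply: is_derive_eq; rewrite add0r mul1r.
  have d1 : is_derive y 1 (fun y : R => mu (X - y)) (- dmu (X - y)).
    have := @is_derive1_comp _ mu (fun y => X - y) y _ _ (mu' (X - y)) dX.
    by rewrite mulrN1.
  exact: is_deriveD.
have [y] := MVT_segment ab (fun y _ => dpsi y)
  (continuous_subspaceT (continuous_is_derive dpsi)).
rewrite in_itv/= => /andP[ay yb] E.
have yr : `|y| <= r by move: ar br; rewrite !ler_norml => /andP[? ?] /andP[? ?]; lra.
rewrite distrC [leRHS]distrC [leRHS](_ : _ = `|psi b - psi a|)// E normrM ler_wpM2r//.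
apply: le_trans (gap y yr) _; rewrite -[`|dmu (X - y)|]normrN.
by rewrite lerBlDr -{1}(addrK (dmu y) (- dmu (X - y))) ler_normB.
Qed.

Lemma sqr_normc_sum_le (R : realType) (I : eqType) (s : seq I) (z : I -> R[i]) :
  Normc.normc (\sum_(k <- s) z k) ^+ 2 <=
  (size s)%:R * \sum_(k <- s) Normc.normc (z k) ^+ 2.
Proof.
have H (x : I -> R) : (\sum_(k <- s) x k) ^+ 2 <= (size s)%:R * \sum_(k <- s) x k ^+ 2.
  apply: le_trans (@schur_sum_le R I s x (fun _ _ => 1) (size s)%:R _ _ _) => //.
    rewrite expr2 mulr_suml; apply: ler_sum => k _; rewrite mulr_sumr.
    by apply: ler_sum => l _; rewrite mulr1.
  by move=> k _; rewrite big_const_seq count_predT iter_addr_0.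
rewrite sqr_normcE !raddf_sum/=; apply: le_trans (lerD (H _) (H _)) _.
rewrite -mulrDr -big_split/= ler_wpM2l//; apply: ler_sum => k _.
by rewrite sqr_normcE.
Qed.

Lemma continuous_sqr_normc_trig (R : realType) (I : Type) (s : seq I)
    (c : I -> R[i]) (omega : I -> R) :
  continuous (fun t : R => Normc.normc (\sum_(k <- s) c k * expi (t * omega k)) ^+ 2).
Proof.
rewrite (_ : (fun _ => _) = fun t : R => \sum_(k <- s) \sum_(l <- s)
  oscillation (cross_re (c k) (c l)) (cross_im (c k) (c l)) (omega k - omega l) t).
  by do 2 apply: continuous_big => ?; exact: continuous_oscillation.
apply/funext => t; rewrite sqr_normc_trig_sum.
by apply: eq_bigr => k _; apply: eq_bigr => l _; rewrite /oscillation mulrBr.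
Qed.

Lemma sum_fibers (V : nmodType) (I J : eqType) (s : seq I) (p : I -> J)
    (cls : seq J) (F : I -> V) : uniq cls -> {in s, forall l, p l \in cls} ->
  \sum_(l <- s) F l = \sum_(c <- cls) \sum_(l <- s | p l == c) F l.
Proof.
move=> ucls pcls; under [RHS]eq_bigr do rewrite big_mkcond/=.
rewrite exchange_big/= big_seq [RHS]big_seq; apply: eq_bigr => l ls.
rewrite (bigD1_seq (p l))//=; last exact: pcls.
by rewrite eqxx big1 ?addr0// => c /negbTE; rewrite eq_sym => ->.
Qed.

(** Cauchy-Schwarz over the fibers of [p], on each of which the frequencies are
    separated and [large_sieve] applies. *)
Lemma large_sieve_fibers (R : realType) (I J : eqType) (s : seq I) (p : I -> J)
    (cls : seq J) (c : I -> R[i]) (omega : I -> R) (d : I -> int) (T delta : R) :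
  0 < T -> 0 < delta <= 1 -> uniq s -> uniq cls ->
  {in s, forall l, p l \in cls} ->
  {in s &, forall k l, p k = p l -> d k = d l -> k = l} ->
  {in s &, forall k l, p k = p l ->
     delta * `|d k - d l|%:~R <= T * `|omega k - omega l|} ->
  (\int[lebesgue_measure]_(t in `[0%R, T])
     (Normc.normc (\sum_(k <- s) c k * expi (t * omega k)) ^+ 2)%:E
   <= (216 / delta ^+ 2 * T * (size cls)%:R *
       \sum_(k <- s) Normc.normc (c k) ^+ 2)%:E)%E.
Proof.
move=> T0 delta01 us ucls pcls dinj gap.
pose fib j := [seq l <- s | p l == j].
pose f j t := Normc.normc (\sum_(k <- fib j) c k * expi (t * omega k)) ^+ 2.
have cf j : continuous (f j) by exact: continuous_sqr_normc_trig.
have mf j (A : set R) : measurable_fun A (fun t => (f j t)%:E).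
  by apply/measurable_EFinP/measurable_funTS; exact: continuous_measurable_fun.
have mF (A : set R) : measurable_fun A
    (fun t => (Normc.normc (\sum_(k <- s) c k * expi (t * omega k)) ^+ 2)%:E).
  apply/measurable_EFinP/measurable_funTS; apply: continuous_measurable_fun.
  exact: continuous_sqr_normc_trig.
apply: (@le_trans _ _ (\int[lebesgue_measure]_(t in `[0%R, T])
    ((size cls)%:R%:E * \sum_(j <- cls) (f j t)%:E))%E).
  apply: ge0_le_integral => //.
  - by move=> t _; rewrite lee_fin sqr_ge0.
  - exact: mF.
  - apply: emeasurable_funM => //; apply: emeasurable_sum => j; exact: mf.
  - move=> t _; rewrite sumEFin -EFinM lee_fin (sum_fibers _ ucls pcls).
    apply: le_trans (sqr_normc_sum_le _ _) _.
    by under eq_bigr do rewrite -big_filter.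
rewrite ge0_integralZl//; last 2 first.
- by apply: emeasurable_sum => j; exact: mf.
- by move=> t _; apply: sume_ge0 => j _; rewrite lee_fin sqr_ge0.
rewrite ge0_integral_sum//; last 2 first.
- by move=> j; exact: mf.
- by move=> j t _; rewrite lee_fin sqr_ge0.
rewrite mulrAC [_ * (size cls)%:R]mulrC EFinM lee_wpmul2l ?lee_fin//.
rewrite (sum_fibers _ ucls pcls) mulr_sumr -sumEFin.
apply: lee_sum => j _; rewrite -[X in (_ <= (_ * X)%:E)%E]big_filter.
have fibP l : l \in fib j -> l \in s /\ p l = j.
  by rewrite mem_filter => /andP[/eqP].
apply: (@large_sieve R I (fib j) c omega d T delta T0 delta01).
  by rewrite filter_uniq.
  by move=> k l /fibP[ks pk] /fibP[ls pl]; apply: dinj => //; rewrite pk.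
by move=> k l /fibP[ks pk] /fibP[ls pl]; apply: gap => //; rewrite pk.
Qed.

Lemma sum_shift (V : nmodType) (G : zmodType) (s1 s3 : seq G) (l : G)
    (F : G -> V) : uniq s1 -> uniq s3 -> {in s1, forall k, k + l \in s3} ->
  \sum_(m <- s3 | m - l \in s1) F (m - l) = \sum_(k <- s1) F k.
Proof.
move=> us1 us3 s13; rewrite -big_filter.
rewrite -(big_map (fun m => m - l) xpredT F); apply: perm_big.
apply: uniq_perm => //.
  by rewrite map_inj_uniq ?filter_uniq//; exact: addIr.
move=> k; apply/mapP/idP => [[m]|ks].
  by rewrite mem_filter => /andP[? _] ->.
by exists (k + l); rewrite ?addrK// mem_filter addrK ks s13.
Qed.

(** Fibers of [erase i] are lines in the i-th coordinate direction. *)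
Definition erase n (i : 'I_n) (l : 'rV[int]_n) : 'rV[int]_n :=
  \row_j (if j == i then 0 else l 0 j).

Lemma size_erase_le n (i : 'I_n) (s : seq 'rV[int]_n) (r : nat) :
  (forall l j, l \in s -> `|l 0 j| <= r%:Z) ->
  (size (undup (map (erase i) s)) <= (2 * r).+1 ^ n.-1)%N.
Proof.
case: n i s => [[]//|n] i s sr /=.
pose code (c : 'rV[int]_n.+1) : {ffun 'I_n -> 'I_(2 * r).+1} :=
  [ffun j => inord `|(c 0 (lift i j) + r%:Z)%R|%N].
set cls := undup _.
have clsP c : c \in cls -> c 0 i = 0 /\ forall j, `|c 0 j| <= r%:Z.
  rewrite mem_undup => /mapP[l ls ->]; split; first by rewrite mxE eqxx.
  by move=> j; rewrite mxE; case: ifP => // _; exact: sr.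
have code_inj : {in cls &, injective code}.
  move=> c c' /clsP[ci cr] /clsP[c'i c'r] /ffunP cc'; apply/rowP => j.
  case: (unliftP i j) => [k ->|->]; last by rewrite ci c'i.
  have := congr1 val (cc' k); rewrite !ffunE /= !inordK.
  - have := cr (lift i k); have := c'r (lift i k).
    by move: (c 0 _) (c' 0 _) => x y; rewrite !ler_norml => /andP[? ?] /andP[? ?]; lia.
  - by have := c'r (lift i k); move: (c' 0 _) => y; rewrite ler_norml; lia.
  - by have := cr (lift i k); move: (c 0 _) => y; rewrite ler_norml; lia.
rewrite -(size_map code) -(card_uniqP _); last first.
  by rewrite map_inj_in_uniq// undup_uniq.
by apply: leq_trans (max_card _) _; rewrite card_ffun !card_ord.
Qed.

(** * The bilinear estimate *)

Lemma norm_coord_le (R : realType) n (xi : 'rV[R]_n) (j : 'I_n) :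
  `|xi 0 j| <= euclidean_norm xi.
Proof.
rewrite -sqrtr_sqr ler_sqrt; last by apply: sumr_ge0 => i _; exact: sqr_ge0.
rewrite (bigD1 j)//= lerDl.
by apply: sumr_ge0 => i _; exact: sqr_ge0.
Qed.

Lemma exists_large_coord (R : realType) n (xi : 'rV[R]_n) : (0 < n)%N ->
  exists j, euclidean_norm xi <= Num.sqrt n%:R * `|xi 0 j|.
Proof.
move=> n0; apply: contrapT => /forallNP small.
have S0 : 0 <= \sum_(i < n) xi 0 i ^+ 2 by apply: sumr_ge0 => i _; exact: sqr_ge0.
have : \sum_(j < n) n%:R * xi 0 j ^+ 2 < \sum_(j < n) euclidean_norm xi ^+ 2.
  apply: ltr_sum => [|j _].
    by apply/hasP; exists (Ordinal n0) => //; rewrite mem_index_enum.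
  have /negP := small j; rewrite -ltNge => h.
  rewrite -[xi 0 j ^+ 2]real_normK ?num_real//.
  rewrite -[n%:R]sqr_sqrtr// -exprMn.
  by rewrite ltr_pXn2r// nnegrE ?mulr_ge0 ?sqrtr_ge0.
rewrite -mulr_sumr sumr_const card_ord -[_ ^+ 2 *+ n]mulr_natl sqr_sqrtr//.
by rewrite ltxx.
Qed.

Lemma expiD (R : realType) (x y : R) : expi (x + y) = expi x * expi y.
Proof.
rewrite /expi cosD sinD; apply/eqP; rewrite eq_complex /=; apply/andP; split; apply/eqP => //.
by rewrite addrC.
Qed.

Lemma pairingD (R : realType) n (k l : 'rV[int]_n) (x : torus R n) :
  pairing (k + l) x = pairing k x + pairing l x.
Proof.
rewrite /pairing -big_split/=; apply: eq_bigr => i _.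
by rewrite mxE intrD mulrDl.
Qed.

Lemma freq_projE (R : realType) n (N : nat) (f : torus R n -> R[i]) x :
  freq_proj N f x =
  \sum_(k <- finmap.enum_fset (fset_set (@frequencies R n N)))
    fourier_coef f k * expi (pairing k x).
Proof. by rewrite /freq_proj fsbig_finite//; exact: finite_frequencies. Qed.

Lemma mul_trig_sums (R : realType) n (s1 s2 s3 : seq 'rV[int]_n)
    (a b : 'rV[int]_n -> R[i]) (x : torus R n) :
  uniq s1 -> uniq s3 -> {in s1 & s2, forall k l, k + l \in s3} ->
  (\sum_(k <- s1) a k * expi (pairing k x)) *
  (\sum_(l <- s2) b l * expi (pairing l x)) =
  \sum_(m <- s3) (\sum_(l <- s2 | m - l \in s1) a (m - l) * b l) * expi (pairing m x).
Proof.
move=> us1 us3 s123; rewrite mulr_sumr.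
transitivity (\sum_(l <- s2) \sum_(m <- s3 | m - l \in s1)
    a (m - l) * b l * expi (pairing m x)).
  rewrite big_seq [RHS]big_seq; apply: eq_bigr => l ls.
  rewrite mulr_suml -(sum_shift (l := l) _ us1 us3); last by move=> k ks; exact: s123.
  apply: eq_bigr => m _; by rewrite mulrACA -expiD -pairingD subrK.
under eq_bigr do rewrite big_mkcond/=.
rewrite exchange_big/=; apply: eq_bigr => m _.
by rewrite mulr_suml [RHS]big_mkcond.
Qed.

Section bilinear.
Context (R : realType) (n : nat) (phi : 'rV[R]_n -> R) (mu dmu : R -> R).
Context (beta delta : R) (K N : nat).
Hypothesis n0 : (0 < n)%N.
Hypothesis phiE : forall xi, phi xi = \sum_(i < n) mu (xi 0 i).
Hypothesis mu' : forall x : R, is_derive x 1 mu (dmu x).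
Hypothesis delta01 : 0 < delta <= 1.
Hypothesis N0 : (0 < N)%N.
Hypothesis KN : 8 * Num.sqrt n%:R * K%:R <= N%:R :> R.
Hypothesis gap : forall x y : R, N%:R <= 2 * (Num.sqrt n%:R * `|x|) ->
  `|y| <= 2 * K%:R -> delta * N%:R `^ beta <= `|dmu x| - `|dmu y|.

(** The contribution of the pairs of frequencies with sum [m].  The separating
    direction [j] depends on [m] only: it is a large coordinate of one m - l0,
    and stays large for all other l because these are at distance O(K) from l0.
    At the time scale N^{-beta} the gap delta N^beta becomes delta. *)
Lemma fixed_sum_frequency (s : seq 'rV[int]_n) (m : 'rV[int]_n)
    (c : 'rV[int]_n -> R[i]) : uniq s ->
  (forall l, l \in s -> euclidean_norm (real_point R l) <= 2 * K%:R) ->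
  (forall l, l \in s -> N%:R <= euclidean_norm (real_point R (m - l))) ->
  (\int[lebesgue_measure]_(t in `[0%R, (N%:R `^ (- beta))%R])
     (Normc.normc (\sum_(l <- s) c l *
        expi (t * (phi (real_point R (m - l)) + phi (real_point R l)))) ^+ 2)%:E
   <= (216 / delta ^+ 2 * N%:R `^ (- beta) * (4 * K).+1%:R ^+ n.-1 *
       \sum_(l <- s) Normc.normc (c l) ^+ 2)%:E)%E.
Proof.
move=> us sK sN.
have [->|[l0 l0s]] : s = [::] \/ exists l0, l0 \in s.
  by case: (s) => [|l0 s']; [left|right; exists l0; rewrite mem_head].
  rewrite integral0_eq ?big_nil ?mulr0// => t _.
  by rewrite big_nil Normc.normc0 expr0n.
have [j Nj] : exists j, N%:R <= Num.sqrt n%:R * `|(m 0 j)%:~R - (l0 0 j)%:~R| :> R.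
  have [j Nj] := exists_large_coord (real_point R (m - l0)) n0.
  by exists j; apply: le_trans (sN _ l0s) _; move: Nj; rewrite !mxE intrD rmorphN.
have coordK l i : l \in s -> `|(l 0 i)%:~R| <= 2 * K%:R :> R.
  by move=> /sK; apply: le_trans; have := norm_coord_le (real_point R l) i; rewrite mxE.
set X : R := (m 0 j)%:~R in Nj.
have gapX y : `|y| <= 2 * K%:R -> delta * N%:R `^ beta <= `|dmu (X - y)| - `|dmu y|.
  move=> yK; apply: gap => //.
  have h : `|X - (l0 0 j)%:~R| <= `|X - y| + 4 * K%:R.
    have -> : X - (l0 0 j)%:~R = (X - y) + (y - (l0 0 j)%:~R) by ring.
    apply: le_trans (ler_normD _ _) _; rewrite lerD2l.
    apply: le_trans (ler_normB _ _) _.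
    by have := coordK _ j l0s; lra.
  have := ler_wpM2l (sqrtr_ge0 n%:R) h.
  by move: Nj KN; set q := Num.sqrt _ => *; lra.
have omegaE l l' : erase j l = erase j l' ->
    (phi (real_point R (m - l)) + phi (real_point R l))
    - (phi (real_point R (m - l')) + phi (real_point R l')) =
    (mu (X - (l 0 j)%:~R) + mu (l 0 j)%:~R)
    - (mu (X - (l' 0 j)%:~R) + mu (l' 0 j)%:~R).
  move=> /rowP E; rewrite !phiE -!big_split/= -sumrB (bigD1 j)//= big1 ?addr0.
    by rewrite !mxE !intrD !rmorphN.
  by move=> i ij; have := E i; rewrite !mxE (negbTE ij) => ->; rewrite subrr.
have T0 : 0 < N%:R `^ (- beta) :> R by rewrite powR_gt0// ltr0n.
apply: le_trans (@large_sieve_fibers R _ _ s (erase j) (undup (map (erase j) s)) c _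
  (fun l => l 0 j) _ delta T0 delta01 us _ _ _ _) _.
- exact: undup_uniq.
- by move=> l ls; rewrite mem_undup map_f.
- move=> k l _ _ /rowP E kl; apply/rowP => i; have := E i; rewrite !mxE.
  by case: eqVneq => [->|].
- move=> k l ks ls E; rewrite omegaE//.
  have := resonance_gap mu' gapX (coordK _ j ks) (coordK _ j ls).
  rewrite -(ler_pM2l T0) => /(le_trans _); apply.
  rewrite !mulrA [_ * delta]mulrC -[delta * _ * _]mulrA -powRD; last first.
    by rewrite pnatr_eq0 -lt0n N0 implybT.
  by rewrite addNr powRr0 mulr1 intr_norm intrD rmorphN.
- rewrite lee_fin ler_wpM2r ?sumr_ge0// => [i _|]; first exact: sqr_ge0.
  rewrite ler_wpM2l//.
    by rewrite mulr_ge0 ?(ltW T0)// divr_ge0// sqr_ge0.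
  rewrite -natrX ler_nat; have := @size_erase_le n j s (2 * K).
  rewrite mulnA; apply => l i ls.
  by rewrite -(ler_int R) intr_norm; have := coordK _ i ls; rewrite PoszM intrM.
Qed.

(** Parseval in x at each time, then [fixed_sum_frequency] for every total
    frequency; the sum over [m] of the sums over [l] factors since m - l runs
    over all of [s1] when [l] is fixed. *)
Lemma bilinear_trig_estimate (s1 s2 : seq 'rV[int]_n)
    (a b : 'rV[int]_n -> R[i]) : uniq s1 -> uniq s2 ->
  (forall k, k \in s1 -> N%:R <= euclidean_norm (real_point R k)) ->
  (forall l, l \in s2 -> euclidean_norm (real_point R l) <= 2 * K%:R) ->
  (L2L2norm (N%:R `^ (- beta)) (fun t (x : torus R n) =>
     ((\sum_(k <- s1) expi (t * phi (real_point R k)) * a k * expi (pairing k x)) *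
     (\sum_(l <- s2) expi (t * phi (real_point R l)) * b l * expi (pairing l x)))%R)
   <= (Num.sqrt ((2 * pi) ^+ n *
        (216 / delta ^+ 2 * N%:R `^ (- beta) * (4 * K).+1%:R ^+ n.-1 *
         ((\sum_(k <- s1) Normc.normc (a k) ^+ 2) *
          (\sum_(l <- s2) Normc.normc (b l) ^+ 2)))))%:E)%E.
Proof.
move=> us1 us2 s1N s2K.
pose s3 := undup [seq k + l | k <- s1, l <- s2].
have us3 : uniq s3 by exact: undup_uniq.
have s123 : {in s1 & s2, forall k l, k + l \in s3}.
  by move=> k l ks ls; rewrite mem_undup; apply: allpairs_f.
pose S m := [seq l <- s2 | m - l \in s1].
pose D m t : R[i] := \sum_(l <- S m) a (m - l) * b l *
   expi (t * (phi (real_point R (m - l)) + phi (real_point R l))).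
have pin0 : 0 <= (2 * pi) ^+ n :> R by rewrite exprn_ge0// mulr_ge0// pi_ge0.
pose G t := (2 * pi) ^+ n * \sum_(m <- s3) Normc.normc (D m t) ^+ 2.
have G0 t : 0 <= G t.
  by rewrite mulr_ge0//; apply: sumr_ge0 => m _; exact: sqr_ge0.
have normE t : L2norm (fun x : torus R n =>
     (\sum_(k <- s1) expi (t * phi (real_point R k)) * a k * expi (pairing k x)) *
     (\sum_(l <- s2) expi (t * phi (real_point R l)) * b l * expi (pairing l x)))
   = (Num.sqrt (G t))%:E.
  rewrite /G -(parseval (fun m => D m t) us3); congr L2norm.
  apply/funext => x; rewrite (mul_trig_sums _ _ _ us1 us3 s123).
  apply: eq_bigr => m _; congr (_ * _); rewrite /D big_filter.
  by apply: eq_bigr => l _; rewrite mulrDr expiD mulrACA mulrC.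
have cD m : continuous (fun t => Normc.normc (D m t) ^+ 2).
  exact: continuous_sqr_normc_trig.
have mD m (A : set R) : measurable_fun A (fun t => (Normc.normc (D m t) ^+ 2)%:E).
  apply/measurable_EFinP/measurable_funTS; apply: continuous_measurable_fun.
  exact: cD.
have mG (A : set R) : measurable_fun A (fun t => (G t)%:E).
  apply/measurable_EFinP/measurable_funTS; apply: continuous_measurable_fun.
  move=> t; apply: cvgM; first exact: cvg_cst.
  exact: continuous_big.
rewrite /L2L2norm (_ : (fun t => L2norm _) = fun t => (Num.sqrt (G t))%:E); last first.
  by apply/funext => t; rewrite normE.
rewrite Lnorm2_EFin; under eq_integral do rewrite sqr_sqrtr//.
rewrite integral_mrestr; last exact: mG.
set Z := (X in (Num.sqrt X)%:E).
have Z0 : 0 <= Z.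
  rewrite mulr_ge0// mulr_ge0//.
    by rewrite mulr_ge0 ?exprn_ge0// mulr_ge0 ?powR_ge0// divr_ge0// sqr_ge0.
  by rewrite mulr_ge0//; apply: sumr_ge0 => k _; exact: sqr_ge0.
rewrite -powR12_sqrt// -poweR_EFin.
apply: gt0_ler_poweR => //.
- by rewrite in_itv/= leey andbT; apply: integral_ge0 => t _; rewrite lee_fin.
- by rewrite in_itv/= leey andbT lee_fin.
under eq_integral do rewrite EFinM -sumEFin.
rewrite ge0_integralZl//; last 2 first.
- by apply: emeasurable_sum => m; exact: mD.
- by move=> t _; apply: sume_ge0 => m _; rewrite lee_fin sqr_ge0.
rewrite ge0_integral_sum//; last 2 first.
- by move=> m; exact: mD.
- by move=> m t _; rewrite lee_fin sqr_ge0.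
rewrite /Z EFinM lee_wpmul2l ?lee_fin//.
apply: (@le_trans _ _ (\sum_(m <- s3) (216 / delta ^+ 2 * N%:R `^ (- beta) *
    (4 * K).+1%:R ^+ n.-1 * \sum_(l <- S m) Normc.normc (a (m - l) * b l) ^+ 2)%:E)%E).
  apply: lee_sum => m _; apply: fixed_sum_frequency; first by rewrite filter_uniq.
    by move=> l; rewrite mem_filter => /andP[_ /s2K].
  by move=> l; rewrite mem_filter => /andP[/s1N].
rewrite sumEFin lee_fin -mulr_sumr ler_wpM2l//.
  by rewrite mulr_ge0 ?exprn_ge0// mulr_ge0 ?powR_ge0// divr_ge0// sqr_ge0.
under eq_bigr do rewrite big_filter big_mkcond/=.
rewrite exchange_big/= mulr_sumr big_seq [leRHS]big_seq.
apply: ler_sum => l ls; rewrite -big_mkcond/=.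
under eq_bigr do rewrite Normc.normcM exprMn.
rewrite -mulr_suml (sum_shift (fun k => Normc.normc (a k) ^+ 2))//.
by move=> k ks; exact: s123.
Qed.

End bilinear.

Lemma frequencies_upper (R : realType) n (K : nat) (l : 'rV[int]_n) :
  frequencies R K l -> euclidean_norm (real_point R l) <= 2 * K%:R.
Proof.
rewrite /frequencies /frequency_range /=.
by case: eqP => [->|_] /andP[_ /ltW]; rewrite ?mulr1.
Qed.

Lemma frequencies_lower (R : realType) n (N : nat) (k : 'rV[int]_n) :
  (1 < N)%N -> frequencies R N k -> N%:R <= euclidean_norm (real_point R k).
Proof.
move=> N1; rewrite /frequencies /frequency_range /= gtn_eqF//.
by case/andP.
Qed.

Lemma freq_proj_propagated (R : realType) n (phi : 'rV[R]_n -> R) (N : nat) t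
    (f g : torus R n -> R[i]) x : is_propagated phi t f g ->
  freq_proj N g x =
  \sum_(k <- finmap.enum_fset (fset_set (frequencies R N)))
    expi (t * phi (real_point R k)) * fourier_coef f k * expi (pairing k x).
Proof. by move=> [_ E]; rewrite freq_projE; apply: eq_bigr => k _; rewrite E. Qed.

Lemma L2norm_freq_proj (R : realType) n (N : nat) (f : torus R n -> R[i]) :
  L2norm (freq_proj N f) = (Num.sqrt ((2 * pi) ^+ n *
    \sum_(k <- finmap.enum_fset (fset_set (frequencies R N)))
      Normc.normc (fourier_coef f k) ^+ 2))%:E.
Proof.
rewrite -parseval ?finmap.fset_uniq//; congr L2norm.
by apply/funext => x; rewrite freq_projE.
Qed.

Theorem proposition2p2 (R : realType) (n : nat) (phi : 'rV[R]_n -> R)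
    (alpha : R) (hn : (1 <= n)%N) (hsmooth : smooth phi)
    (hsum : sum_type phi) (halpha : 1 < alpha)
    (hgrad : gradient_growth alpha phi) :
  exists c C : R, [/\ 0 < c, 0 < C &
    forall (i j : nat), let K : nat := (2 ^ i)%N in let N : nat := (2 ^ j)%N in
      K%:R <= c * N%:R ->
      forall (u1 u2 : torus R n -> R[i]%C) (v1 v2 : R -> torus R n -> R[i]%C),
        L2torus u1 -> L2torus u2 ->
        (forall t, is_propagated phi t u1 (v1 t)) ->
        (forall t, is_propagated phi t u2 (v2 t)) ->
        (L2L2norm (N%:R `^ (- (alpha - 1)))
           (fun t x => (freq_proj N (v1 t) x * freq_proj K (v2 t) x)%R)
         <= (C * (K%:R `^ ((n%:R - 1) / 2) / N%:R `^ ((alpha - 1) / 2)))%:E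
            * L2norm (freq_proj N u1) * L2norm (freq_proj K u2))%E].
Proof.
move: hsum => [mu _ phiE].
have [dmu [mu' cdmu [C0 C00 growth]]] := sum_type_profile hn hsmooth phiE hgrad.
have s1 : 1 <= Num.sqrt n%:R :> R.
  by rewrite -[X in X <= _]sqrtr1 ler_wsqrtr// (ler_nat _ 1).
have [c [d0 [c0 d00 gap0]]] := profile_gap s1 halpha C00 cdmu growth.
pose s : R := Num.sqrt n%:R.
pose beta := alpha - 1.
pose delta := Num.min d0 1.
have delta01 : 0 < delta <= 1 by rewrite lt_min d00 ltr01 ge_min lexx orbT.
have s0 : 0 < 8 * s by rewrite mulr_gt0//; apply: lt_le_trans s1.
pose P : R := (2 * pi) ^+ n.
have P0 : 0 < P by rewrite exprn_gt0// mulr_gt0// pi_gt0.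
(* 5 because lines are counted by (4K + 1)^(n - 1) and 1 <= K; P because
   Parseval gives one factor P on the left and two on the right. *)
pose C := Num.sqrt (216 / delta ^+ 2 * 5 ^+ n.-1 / P).
have C0' : 0 < C.
  rewrite sqrtr_gt0 divr_gt0// mulr_gt0 ?exprn_gt0//.
  by case/andP: delta01 => ? _; rewrite divr_gt0// exprn_gt0.
(* (8 sqrt n)^-1 keeps sqrt n times 4K, the spread of m_j - y over |y| <= 2K,
   below N / 2. *)
exists (Num.min c (8 * s)^-1), C; split => //.
  by rewrite lt_min c0 invr_gt0.
move=> i j K N KN u1 u2 v1 v2 _ _ hv1 hv2.
have K1 : 1 <= K%:R :> R by rewrite (ler_nat _ 1) expn_gt0.
have N0R : 0 <= N%:R :> R by exact: ler0n.
have KcN : K%:R <= c * N%:R.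
  by apply: le_trans KN _; rewrite ler_wpM2r// ge_min lexx.
have KsN : 8 * s * K%:R <= N%:R.
  rewrite -ler_pdivlMl//; apply: le_trans KN _.
  by rewrite ler_wpM2r// ge_min lexx orbT.
have N8 : 8 <= N%:R :> R.
  apply: le_trans KsN; rewrite -{1}[8]mulr1 -mulrA ler_pM2l//.
  exact: mulr_ege1.
have N1 : (1 < N)%N by rewrite -(ltr_nat R); lra.
have gap x y : N%:R <= 2 * (s * `|x|) -> `|y| <= 2 * K%:R ->
    delta * N%:R `^ beta <= `|dmu x| - `|dmu y|.
  move=> Nx yK; apply: le_trans (gap0 _ _ x y K1 _ KcN Nx yK); last by lra.
  by rewrite ler_wpM2r ?powR_ge0// ge_min lexx.
pose s_ M := finmap.enum_fset (fset_set (@frequencies R n M)).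
have s_P M k : k \in s_ M -> frequencies R M k.
  by rewrite in_fset_set ?inE//; exact: finite_frequencies.
have := bilinear_trig_estimate hn phiE mu' delta01 (ltnW N1) KsN gap
  (fourier_coef u1) (fourier_coef u2)
  (finmap.fset_uniq (fset_set (@frequencies R n N)))
  (finmap.fset_uniq (fset_set (@frequencies R n K)))
  (fun k kN => frequencies_lower N1 (s_P N k kN))
  (fun l lK => frequencies_upper (s_P K l lK)).
set A := \sum_(k <- _) _; set B := \sum_(l <- _) _; set Fseq := (fun t x => _).
rewrite (_ : (fun t x => freq_proj N (v1 t) x * freq_proj K (v2 t) x)%R = Fseq); last first.
  apply/funext => t; apply/funext => x.
  by rewrite (freq_proj_propagated N x (hv1 t)) (freq_proj_propagated K x (hv2 t)).
move=> /le_trans; apply; rewrite !L2norm_freq_proj -/A -/B -!EFinM lee_fin.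
have A0 : 0 <= A by apply: sumr_ge0 => k _; exact: sqr_ge0.
have B0 : 0 <= B by apply: sumr_ge0 => k _; exact: sqr_ge0.
have powR_half_sqr (x r : R) : (x `^ (r / 2)) ^+ 2 = x `^ r.
  by rewrite -powR_mulrn ?powR_ge0// -powRrM divfK.
set y := (X in _ <= X).
have y0 : 0 <= y.
  by rewrite !mulr_ge0 ?sqrtr_ge0// ?powR_ge0// invr_ge0 powR_ge0.
rewrite -(ger0_norm y0) -sqrtr_sqr ler_sqrt ?sqr_ge0//.
have -> : y ^+ 2 = 216 / delta ^+ 2 * (5 * K%:R) ^+ n.-1 / N%:R `^ beta * P * (A * B).
  rewrite /y -/P !exprMn exprVn !powR_half_sqr.
  rewrite [in LHS]sqr_sqrtr; last first.
    by rewrite divr_ge0 ?(ltW P0)// mulr_ge0 ?exprn_ge0// divr_ge0// sqr_ge0.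
  rewrite [in LHS]sqr_sqrtr ?mulr_ge0 ?(ltW P0)//.
  rewrite [in LHS]sqr_sqrtr ?mulr_ge0 ?(ltW P0)//.
  have -> : K%:R `^ (n%:R - 1) = K%:R ^+ n.-1 :> R.
    by rewrite -powR_mulrn// -{1}(prednK hn) -natr1 addrK.
  rewrite -/beta; field; rewrite !gt_eqF//; first by case/andP: delta01.
  by rewrite powR_gt0// (lt_le_trans _ N8).
pose W := 216 / delta ^+ 2 / N%:R `^ beta * P * (A * B).
have W0 : 0 <= W.
  rewrite !mulr_ge0// ?invr_ge0 ?powR_ge0 ?sqr_ge0//.
  exact: ltW.
rewrite powRN -/P.
rewrite (_ : P * _ = W * (4 * K).+1%:R ^+ n.-1); last by rewrite /W; ring.
rewrite (_ : _ * P * _ = W * (5 * K%:R) ^+ n.-1); last by rewrite /W; ring.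
rewrite ler_wpM2l// lerXn2r ?nnegrE ?mulr_ge0//.
by rewrite -natr1 natrM; lra.
Qed.
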